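(* For any $n\ge1$, $$\sum_{\pi\in\mathfrak{S}_n(231)}(-1)^{\mathsf{des}\,\pi}q^{(31\text{-}2)\pi}=\sum_{\pi\in\mathfrak{S}_n(231)}(-1)^{\mathsf{des}\,\pi}q^{(13\text{-}2)\pi}=\begin{cases}0,&n\text{ even},\\(-q)^{(n-1)/2}C_{(n-1)/2}(q^2),&n\text{ odd},\end{cases}$$ $$\sum_{\pi\in\mathfrak{D}^*_n(231)}(-q)^{\mathsf{des}\,\pi}q^{(31\text{-}2)\pi}=\begin{cases}(-q)^{n/2}C_{n/2}(q^2),&n\text{ even},\\0,&n\text{ odd},\end{cases}\qquad \sum_{\pi\in\mathfrak{D}^*_n(231)}(-1)^{\mathsf{des}\,\pi}q^{(13\text{-}2)\pi}=\begin{cases}(-1)^{n/2}C^*_{n/2}(q),&n\text{ even},\\0,&n\text{ odd},\end{cases}$$ where $C^*_m(q):=\sum_{\pi\in\mathfrak{A}_{2m}(132)}q^{(2\text{-}31)\pi}$.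
   Context: $C_n(q):=C_n(q,q^2)$, where $C_n(t,q)$ is defined by $\sum_{n\ge0}C_n(t,q)z^n=1/(1-c_1z/(1-c_2z/(1-c_3z/\cdots)))$ with $c_{2k-1}=q^{k-1}$, $c_{2k}=tq^{k-1}$. $\mathfrak{S}_n(\tau)$: permutations of $[n]$ avoiding classical pattern $\tau$. For $\pi\in\mathfrak{S}_n$ set $\pi(n+1)=n+1$; $\pi(i)$ is a foremaximum if $\pi(i)<\pi(i+1)$ and $\pi(i)=\max\{\pi(1),\dots,\pi(i)\}$; a coderangement has no foremaximum; $\mathfrak{D}^*_n(\tau)$ is the set of coderangements in $\mathfrak{S}_n(\tau)$. $\mathfrak{A}_n(\tau)$ is the set of alternating (up-down) permutations $\pi(1)<\pi(2)>\pi(3)<\cdots$ in $\mathfrak{S}_n(\tau)$. $\mathsf{des}\,\pi=\#\{i\in[n-1]:\pi(i)>\pi(i+1)\}$; $(31\text{-}2)\pi=\#\{(i,j):i+1<j\le n,\pi(i+1)<\pi(j)<\pi(i)\}$, $(2\text{-}31)\pi=\#\{(i,j):j<i<n,\pi(i+1)<\pi(j)<\pi(i)\}$, $(13\text{-}2)\pi=\#\{(i,j):i+1<j\le n,\pi(i)<\pi(j)<\pi(i+1)\}$. *)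

(* Defs.v *)
From HB Require Import structures.
From mathcomp Require Import all_boot all_order all_algebra all_fingroup.
Set Implicit Arguments. Unset Strict Implicit. Unset Printing Implicit Defensive.
Import GRing.Theory.
Local Open Scope ring_scope.

(* For a coefficient sequence c (c 0 = c_1, c 1 = c_2, ...), F_k(z) denotes the
   tail continued fraction 1/(1 - c_k z/(1 - c_{k+1} z/ ...)); it is the unique
   formal power series with F_k = 1 + c_k z F_{k+1} F_k.  [cf_coeffs c m k] is
   the list of the coefficients of z^0..z^m of F_k (k 0-based). *)
Fixpoint cf_coeffs (R : comRingType) (c : nat -> R) (m : nat) : nat -> seq R :=
  match m with
  | 0 => fun _ => [:: 1]
  | m'.+1 => fun k =>
      let prev := cf_coeffs c m' in
      rcons (prev k)
        (c k * \sum_(i < m'.+1) (prev k.+1)`_i * (prev k)`_(m' - i))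
  end.

Definition cf_coef (R : comRingType) (c : nat -> R) (n : nat) : R :=
  (cf_coeffs c n 0)`_n.

(* c_{2k-1} = q^{k-1}, c_{2k} = t q^{k-1}; shifted to 0-based index j = index-1 *)
Definition Ccoef (R : comRingType) (t q : R) (j : nat) : R :=
  (if odd j then t else 1) * q ^+ j./2.

Definition Ctq (R : comRingType) (t q : R) (n : nat) : R := cf_coef (Ccoef t q) n.

Definition Cq (R : comRingType) (q : R) (n : nat) : R := Ctq q (q ^+ 2) n.

Definition word n (p : 'S_n) : seq nat := [seq val (p i) | i <- enum 'I_n].

Definition contains (tau : seq nat) n (p : 'S_n) : bool :=
  [exists f : {ffun 'I_(size tau) -> 'I_n},
    [forall a : 'I_(size tau), forall b : 'I_(size tau),
      ((a < b)%N ==> (f a < f b)%N) &&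
      (((p (f a) < p (f b))%N) == (nth 0 tau a < nth 0 tau b)%N)]].

Definition avoids (tau : seq nat) n (p : 'S_n) : bool := ~~ contains tau p.

(* statistics, with 0-based positions i (position i here = position i+1 in the paper) *)
Definition des n (p : 'S_n) : nat :=
  let w := word p in
  \sum_(i < n.-1) (nth 0 w i.+1 < nth 0 w i)%N.

Definition st31_2 n (p : 'S_n) : nat :=
  let w := word p in
  \sum_(i < n.-1) \sum_(i.+2 <= j < n)
     ((nth 0 w i.+1 < nth 0 w j) && (nth 0 w j < nth 0 w i))%N.

Definition st2_31 n (p : 'S_n) : nat :=
  let w := word p in
  \sum_(i < n.-1) \sum_(0 <= j < i)
     ((nth 0 w i.+1 < nth 0 w j) && (nth 0 w j < nth 0 w i))%N.

Definition st13_2 n (p : 'S_n) : nat :=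
  let w := word p in
  \sum_(i < n.-1) \sum_(i.+2 <= j < n)
     ((nth 0 w i < nth 0 w j) && (nth 0 w j < nth 0 w i.+1))%N.

(* extended word: value at position n is n (i.e. pi(n+1) = n+1 in 1-based terms) *)
Definition wext n (p : 'S_n) (i : nat) : nat :=
  if (i < n)%N then nth 0 (word p) i else n.

Definition foremax n (p : 'S_n) (i : nat) : bool :=
  (wext p i < wext p i.+1)%N && [forall j : 'I_n, (j <= i)%N ==> (wext p j <= wext p i)%N].

Definition coderangement n (p : 'S_n) : bool :=
  [forall i : 'I_n, ~~ foremax p i].

Definition alternating n (p : 'S_n) : bool :=
  [forall i : 'I_n.-1, (nth 0 (word p) i < nth 0 (word p) i.+1)%N == ~~ odd i].

Definition Cstar (R : comRingType) (q : R) (m : nat) : R :=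
  \sum_(p : 'S_(m.*2) | alternating p && avoids [:: 1; 3; 2] p) q ^+ st2_31 p.

(* Main.v *)
Require Import Defs.
From HB Require Import structures.
From mathcomp Require Import all_boot all_order all_algebra all_fingroup.
From mathcomp Require Import qpoly ring zify.
Set Implicit Arguments.
Unset Strict Implicit.
Unset Printing Implicit Defensive.
Import GRing.Theory.

(** A 231-avoiding permutation is x u v where x is its first letter, u a
    231-avoiding arrangement of the letters below x and v one of those above x;
    such permutations are therefore binary trees, and each statistic changes by
    the size of one subtree when a node is formed.  With t marking descents,
    this gives functional equations linking a series at z and at qz:
      31-2 :  F(z) = 1 + z E(z) F(z),   E(z) = 1 + t z E(z) F(qz),
      13-2 :  F(z) = 1 + z P(z) W(z),   W(z) = 1 + z P(qz) W(z),   P = 1 - t + t F,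
    where E, P and W record a larger (E, P) or smaller (W) letter placed in
    front.  Coderangements only require u to be nonempty at the nodes of the
    right spine.  Let A be the even series A(z) = 1 - q z^2 A(qz) A(z); its
    coefficients are (-q)^m C_m(q^2).  Then F = 1 + z A solves both systems at
    t = -1, the coderangement series is A for 31-2 at t = -q, and it is
    1 - z^2 A^2 for 13-2 at t = -1.  Reversal turns up-down 132-avoiding words of
    even length into down-up 231-avoiding ones and 2-31 into 13-2; their series
    is 1 + z^2 B^2 with B(z) = 1 + q z^2 B(qz) B(z), which is A up to the sign
    (-1)^m in degree 2m. *)

(** * Binary trees *)

Inductive tree := Leaf | Node of tree & tree.

Fixpoint tree_eqb (s t : tree) : bool :=
  match s, t with
  | Leaf, Leaf => true
  | Node l r, Node l' r' => tree_eqb l l' && tree_eqb r r'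
  | _, _ => false
  end.

Lemma tree_eqP : Equality.axiom tree_eqb.
Proof.
elim=> [|l IHl r IHr] [|l' r'] /=; try by constructor.
apply: (iffP andP) => [[/IHl -> /IHr -> //]|[<- <-]].
by split; [apply/IHl | apply/IHr].
Qed.

HB.instance Definition _ := hasDecEq.Build tree tree_eqP.

Fixpoint nodes (t : tree) : nat :=
  if t is Node l r then (nodes l + nodes r).+1 else 0.

(** Fuel is used because the calls at [k] and [n' - k] are not structurally smaller; any fuel at
    least [n] gives the same list. *)
Fixpoint trees_fuel (fuel n : nat) : seq tree :=
  if n is n'.+1 then
    if fuel is fuel'.+1 then
      [seq Node p.1 p.2 | k <- iota 0 n,
         p <- [seq (l, r) | l <- trees_fuel fuel' k, r <- trees_fuel fuel' (n' - k)]]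
    else [::]
  else [:: Leaf].

Definition trees n := trees_fuel n n.

Lemma trees_fuelS fuel n : trees_fuel fuel.+1 n.+1 =
  [seq Node p.1 p.2 | k <- iota 0 n.+1,
     p <- [seq (l, r) | l <- trees_fuel fuel k, r <- trees_fuel fuel (n - k)]].
Proof. by []. Qed.

Lemma trees_fuel_enough fuel n : n <= fuel -> trees_fuel fuel n = trees n.
Proof.
rewrite /trees; elim/ltn_ind: n fuel => [[|n]] IH [|fuel] // lt_n; rewrite !trees_fuelS.
apply: (congr1 flatten); apply/eq_in_map => k; rewrite mem_iota /= => lt_k.
by rewrite !(IH k) ?(IH (n - k)) //; lia.
Qed.

Lemma treesS n : trees n.+1 =
  [seq Node p.1 p.2 | k <- iota 0 n.+1,
     p <- [seq (l, r) | l <- trees k, r <- trees (n - k)]].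
Proof.
rewrite /trees trees_fuelS.
apply: (congr1 flatten); apply/eq_in_map => k; rewrite mem_iota /= => lt_k.
by rewrite !(trees_fuel_enough (n := k)) ?(trees_fuel_enough (n := n - k)) //; lia.
Qed.

Lemma big_trees0 (R : comNzRingType) (F : tree -> R) :
  (\sum_(t <- trees 0) F t = F Leaf)%R.
Proof. by rewrite big_seq1. Qed.

Lemma big_treesS (R : comNzRingType) (F : tree -> R) n :
  (\sum_(t <- trees n.+1) F t =
   \sum_(k < n.+1) \sum_(l <- trees k) \sum_(r <- trees (n - k)) F (Node l r))%R.
Proof.
rewrite treesS big_allpairs_dep -{1}(subn0 n.+1) -/(index_iota 0 n.+1) big_mkord.
by apply: eq_bigr => k _; rewrite big_allpairs_dep.
Qed.

Lemma mem_trees n t : (t \in trees n) = (nodes t == n).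
Proof.
elim/ltn_ind: n t => n IH t; case: n IH => [|n] IH.
  by rewrite inE; case: t.
rewrite treesS; apply/allpairsPdep/eqP => [[k [p []]]|].
  rewrite mem_iota /= => lt_k /allpairsPdep[l [r []]].
  rewrite !IH; [|lia|lia].
  by move=> /eqP l_k /eqP r_k -> -> /=; lia.
case: t => [//|l r] sz; exists (nodes l), (l, r).
split=> //; first by rewrite mem_iota; move: sz => /=; lia.
move: sz => /= sz; apply/allpairsPdep; exists l, r.
by rewrite !IH; [split=> //; apply/eqP; lia | lia | lia].
Qed.

Lemma trees_uniq n : uniq (trees n).
Proof.
elim/ltn_ind: n => [[|n]] IH //; rewrite treesS.
apply: allpairs_uniq_dep.
- exact: iota_uniq.
- move=> k; rewrite mem_iota /= => lt_k.
  by apply: allpairs_uniq; [apply: IH; lia | apply: IH; lia | move=> [? ?] [? ?]].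
move=> x y /allpairsPdep[k1 [[l1 r1] [_ p1_in ->]]].
move=> /allpairsPdep[k2 [[l2 r2] [_ p2_in ->]]] /= [eq_l eq_r].
(* The splitting index is recovered as the size of the left subtree, so different indices contribute
   different trees. *)
have [sz1 sz2] : nodes l1 = k1 /\ nodes l2 = k2.
  move: p1_in p2_in => /allpairsPdep[? [? [+ _ [-> _]]]] /allpairsPdep[? [? [+ _ [-> _]]]].
  by rewrite !mem_trees => /eqP -> /eqP ->.
by rewrite -sz1 -sz2 eq_l eq_r.
Qed.

(** * 231-avoiding words *)

(* The nodes of [t] are labelled o, ..., o + nodes t - 1 in inorder and read in preorder. *)
Fixpoint tword (o : nat) (t : tree) : seq nat :=
  if t is Node l r then
    (o + nodes l) :: tword o l ++ tword (o + nodes l).+1 r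
  else [::].

Lemma perm_tword o t : perm_eq (tword o t) (iota o (nodes t)).
Proof.
elim: t o => [//|l IHl r IHr] o.
have -> : nodes (Node l r) = nodes l + (nodes r).+1 by rewrite addnS.
by rewrite iotaD /= -cat1s perm_catCA perm_cat //= perm_cons.
Qed.

Lemma size_tword o t : size (tword o t) = nodes t.
Proof. by rewrite (perm_size (perm_tword o t)) size_iota. Qed.

Lemma mem_tword o t x : (x \in tword o t) = (o <= x < o + nodes t).
Proof. by rewrite (perm_mem (perm_tword o t)) mem_iota. Qed.

(** The first letter reveals the size of the left subtree, hence where to cut the rest of the
    word. *)
Lemma tword_inj o : injective (tword o).
Proof.
move=> s t; elim: s t o => [|l IHl r IHr] [|l' r'] o //= [/addnI eq_sz].
rewrite eq_sz => /eqP; rewrite eqseq_cat ?size_tword //.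
by move=> /andP[/eqP/IHl -> /eqP/IHr ->].
Qed.

(** Each letter in turn is tested in the role of the 2 of the pattern. *)
Fixpoint av231 (s : seq nat) : bool :=
  if s is x :: s' then
    pairwise (fun y z => ~~ ((x < y) && (z < x))) s' && av231 s'
  else true.

Lemma av231P w : reflect
  (forall i j k, i < j -> j < k -> k < size w ->
     ~~ ((nth 0 w k < nth 0 w i) && (nth 0 w i < nth 0 w j))) (av231 w).
Proof.
elim: w => [|x w IH]; first by constructor.
rewrite /=; apply: (iffP andP) => [[/(pairwiseP 0) pw /IH avw] [|i] [|j] [|k] //|avw].
- move=> _ lt_jk lt_k /=; rewrite andbC; apply: pw => //.
  exact: (ltn_trans lt_jk lt_k).
- by rewrite !ltnS; apply: avw.
split.
  apply/(pairwiseP 0) => j k /= _ lt_k lt_jk; rewrite andbC.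
  exact: (avw 0 j.+1 k.+1).
by apply/IH => i j k lt_ij lt_jk lt_k; apply: (avw i.+1 j.+1 k.+1).
Qed.

(** No occurrence straddles the cut: a 2 in [u] cannot have its 1 among the larger letters of [v].
    The bound on [u] is weak so that [x] itself may lie in [u]. *)
Lemma av231_cat x u v : all (fun y => y <= x) u -> all (fun y => x < y) v ->
  av231 (u ++ v) = av231 u && av231 v.
Proof.
move=> + v_gt; elim: u => [//|y u IH] /= /andP[le_yx u_le].
rewrite pairwise_cat IH // -!andbA.
have -> : allrel (fun y0 z => ~~ ((y < y0) && (z < y))) u v.
  apply/allrelP => b c _ /(allP v_gt) lt_xc.
  by rewrite (leq_gtF (ltnW (leq_ltn_trans le_yx lt_xc))) andbF.
have -> : pairwise (fun y0 z => ~~ ((y < y0) && (z < y))) v.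
  apply/(pairwiseP 0) => b c _ c_lt _; have /(allP v_gt) lt_xc := mem_nth 0 c_lt.
  by rewrite (leq_gtF (ltnW (leq_ltn_trans le_yx lt_xc))) andbF.
by [].
Qed.

Lemma tword_le o l : all (fun y => y < o + nodes l) (tword o l).
Proof. by apply/allP => y; rewrite mem_tword => /andP[]. Qed.

Lemma tword_ge o t : all (fun y => o <= y) (tword o t).
Proof. by apply/allP => y; rewrite mem_tword => /andP[]. Qed.

Lemma av231_tword o t : av231 (tword o t).
Proof.
elim: t o => [//|l IHl r IHr] o; rewrite [tword _ _]/= -cat_cons.
rewrite (@av231_cat (o + nodes l)) ?IHr ?tword_ge ?andbT //=; last first.
  by rewrite leqnn; apply/allP => y; rewrite mem_tword => /andP[_ /ltnW].
rewrite IHl andbT; apply/(pairwiseP 0) => j k j_lt _ _.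
by rewrite ltnNge ltnW // (allP (tword_le o l)) // mem_nth.
Qed.

(** The hypothesis says that every entry after one in [P] is again in [P]. *)
Lemma pairwise_filter_cat (T : eqType) (P : pred T) s :
  pairwise (fun y z => ~~ (P y && ~~ P z)) s ->
  s = [seq y <- s | ~~ P y] ++ [seq y <- s | P y].
Proof.
elim: s => [//|y s IH] /= /andP[y_s /IH {1}->].
have [Py|//] := boolP (P y).
have s_P : all P s by apply: sub_all y_s => z; rewrite /= Py negbK.
have -> : [seq z <- s | ~~ P z] = [::].
  by apply/eqP; rewrite -(negbK (_ == _)) -has_filter has_predC s_P.
by rewrite /= (all_filterP s_P).
Qed.

(** With the first letter as 2, avoidance puts the smaller letters before the larger ones; strong
    induction then treats the two blocks, each an interval of values with its own offset. *)
Lemma tword_surj o n w : perm_eq w (iota o n) -> av231 w ->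
  exists2 t, nodes t = n & tword o t = w.
Proof.
elim/ltn_ind: n o w => [[|n]] IH o w perm_w.
  by move: perm_w => /perm_nilP ->; exists Leaf.
have w_uniq : uniq w by rewrite (perm_uniq perm_w) iota_uniq.
have mem_w y : (y \in w) = (o <= y < o + n.+1) by rewrite (perm_mem perm_w) mem_iota.
case: w perm_w w_uniq mem_w => [/perm_size //|x s] perm_w /= /andP[x_s s_uniq] mem_w.
move=> /andP[s_pw s_av].
have x_in : o <= x < o + n.+1 by rewrite -mem_w mem_head.
have mem_s y : (y \in s) = (o <= y < o + n.+1) && (y != x).
  by rewrite -mem_w inE; case: eqP => [->|_]; rewrite ?(negbTE x_s) ?andbT.
have sE : s = [seq y <- s | ~~ (x < y)] ++ [seq y <- s | x < y].
  apply: pairwise_filter_cat.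
  apply: (sub_in_pairwise (P := mem s)) s_pw; last by apply/allP.
  by move=> y z _ /=; rewrite mem_s => /andP[_ ne_zx]; lia.
set u := filter _ _ in sE; set v := filter _ _ in sE.
have [k kE] : exists k, x = o + k by exists (x - o); lia.
have le_kn : k <= n by lia.
have av_uv : av231 u && av231 v.
  rewrite -(@av231_cat x) -?sE //; apply/allP => y; rewrite mem_filter => /andP[] //.
  by rewrite -leqNgt.
have perm_u : perm_eq u (iota o k).
  apply: uniq_perm; rewrite ?filter_uniq ?iota_uniq // => y.
  by rewrite mem_filter mem_s mem_iota; lia.
have perm_v : perm_eq v (iota (o + k).+1 (n - k)).
  apply: uniq_perm; rewrite ?filter_uniq ?iota_uniq // => y.
  by rewrite mem_filter mem_s mem_iota; lia.
have [av_u av_v] := andP av_uv.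
have [l szl wl] := IH k le_kn o u perm_u av_u.
have [r szr wr] := IH (n - k) (leq_subr k n) (o + k).+1 v perm_v av_v.
exists (Node l r); first by rewrite /= szl szr subnKC.
by rewrite /= szl wl wr -kE -sE.
Qed.

Lemma perm_av231_trees n :
  perm_eq [seq w <- permutations (iota 0 n) | av231 w] [seq tword 0 t | t <- trees n].
Proof.
apply: uniq_perm.
- by rewrite filter_uniq // permutations_uniq.
- by rewrite map_inj_uniq ?trees_uniq //; apply: tword_inj.
move=> w; rewrite mem_filter mem_permutations andbC.
apply/andP/mapP => [[perm_w av_w]|[t t_in ->]].
  have [t sz_t <-] := tword_surj perm_w av_w.
  by exists t => //; rewrite mem_trees sz_t.
rewrite av231_tword; split=> //.
by move: t_in; rewrite mem_trees => /eqP <-; apply: perm_tword.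
Qed.

(** * Permutations as words *)

Lemma nth_word n (p : 'S_n) (i : 'I_n) : nth 0 (word p) i = p i.
Proof. by rewrite (nth_map i) ?size_enum_ord // nth_ord_enum. Qed.

Lemma size_word n (p : 'S_n) : size (word p) = n.
Proof. by rewrite size_map size_enum_ord. Qed.

Lemma word_inj n : injective (@word n).
Proof.
move=> p r eq_pr; apply/permP => i; apply: val_inj.
by rewrite /= -!nth_word eq_pr.
Qed.

Lemma perm_word n (p : 'S_n) : perm_eq (word p) (iota 0 n).
Proof.
apply: uniq_perm; rewrite ?iota_uniq //.
  by rewrite map_inj_uniq ?enum_uniq // => i j /val_inj/perm_inj.
move=> x; rewrite mem_iota /= add0n; apply/mapP/idP => [[i _ ->]|lt_xn]; first exact: ltn_ord.
by exists (p^-1%g (Ordinal lt_xn)); rewrite ?mem_enum // permKV.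
Qed.

Lemma perm_words n :
  perm_eq [seq word p | p <- index_enum {perm 'I_n}] (permutations (iota 0 n)).
Proof.
have u_words : uniq [seq word p | p <- index_enum {perm 'I_n}].
  by rewrite map_inj_uniq ?index_enum_uniq //; apply: word_inj.
have sub_words : {subset [seq word p | p <- index_enum {perm 'I_n}] <= permutations (iota 0 n)}.
  by move=> w /mapP[p _ ->]; rewrite mem_permutations perm_word.
apply: uniq_perm; rewrite ?permutations_uniq //.
(* A duplicate-free sublist of the same size is the whole list up to order; both sizes are n!. *)
suff le_size : size (permutations (iota 0 n)) <=
    size [seq word p | p <- index_enum {perm 'I_n}].
  exact: (uniq_min_size u_words sub_words le_size).2.
rewrite size_permutations ?iota_uniq // size_iota size_map -card_Sn.
by rewrite cardT enumT.
Qed.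

Lemma big_word (R : comNzRingType) n (P : pred (seq nat)) (F : seq nat -> R) :
  (\sum_(p : 'S_n | P (word p)) F (word p) =
   \sum_(w <- permutations (iota 0 n) | P w) F w)%R.
Proof. by rewrite -(perm_big _ (perm_words n)) big_map. Qed.

Lemma big_av231 (R : comNzRingType) n (P : pred (seq nat)) (F : seq nat -> R) :
  (\sum_(w <- permutations (iota 0 n) | av231 w && P w) F w =
   \sum_(t <- trees n | P (tword 0 t)) F (tword 0 t))%R.
Proof. by rewrite -big_filter_cond (perm_big _ (perm_av231_trees n)) big_map. Qed.

(** * Statistics on words *)

Lemma contains3P n (p : 'S_n) (x y z : nat) : reflect
  (exists i j k : 'I_n, [/\ i < j, j < k,
     ((p i < p j) == (x < y)) && ((p j < p i) == (y < x)),
     ((p i < p k) == (x < z)) && ((p k < p i) == (z < x)) &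
     ((p j < p k) == (y < z)) && ((p k < p j) == (z < y))])
  (contains [:: x; y; z] p).
Proof.
pose o0 : 'I_3 := inord 0; pose o1 : 'I_3 := inord 1; pose o2 : 'I_3 := inord 2.
apply: (iffP existsP) => [[f /'forall_forallP fP]|[i [j [k [lt_ij lt_jk]]]]].
  have ord_lt (a b : 'I_3) : a < b -> f a < f b by have /andP[/implyP] := fP a b.
  have val_lt (a b : 'I_3) : (p (f a) < p (f b)) == (nth 0 [:: x; y; z] a < nth 0 [:: x; y; z] b).
    by have /andP[] := fP a b.
  exists (f o0), (f o1), (f o2).
  by split; rewrite ?ord_lt ?inordK //; do ?(apply/andP; split);
     rewrite (eqP (val_lt _ _)) !inordK.
move=> /andP[/eqP ij /eqP ji] /andP[/eqP ik /eqP ki] /andP[/eqP jk /eqP kj].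
exists [ffun a : 'I_3 => nth i [:: i; j; k] a].
apply/'forall_forallP => a b; rewrite !ffunE.
have lt_ik := ltn_trans lt_ij lt_jk.
by case: a => [[|[|[|a]]] ?] //; case: b => [[|[|[|b]]] ?] //=;
  rewrite ?ltnn ?ij ?ji ?ik ?ki ?jk ?kj ?lt_ij ?lt_ik ?lt_jk eqxx.
Qed.

Lemma avoids231E n (p : 'S_n) : avoids [:: 2; 3; 1] p = av231 (word p).
Proof.
apply/idP/av231P => [/contains3P avp i j k lt_ij lt_jk|avp].
  rewrite size_word => lt_k; apply/negP => /andP[lt_ki lt_ij'].
  have lt_j := ltn_trans lt_jk lt_k; have lt_i := ltn_trans lt_ij lt_j.
  apply: avp; exists (Ordinal lt_i), (Ordinal lt_j), (Ordinal lt_k).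
  move: lt_ki lt_ij'; rewrite -[i]/(val (Ordinal lt_i)) -[j]/(val (Ordinal lt_j)).
  rewrite -[k]/(val (Ordinal lt_k)) !nth_word /= => lt_ki lt_ij'.
  by split=> //; lia.
apply/contains3P => -[i [j [k [lt_ij lt_jk]]]] vij vik vjk.
have lt_k : k < size (word p) by rewrite size_word.
by apply: (negP (avp i j k lt_ij lt_jk lt_k)); rewrite !nth_word; lia.
Qed.

(** Reversal sends position [i] to [n - i.+1] and the pattern 132 to 231. *)
Lemma avoids132E n (p : 'S_n) : avoids [:: 1; 3; 2] p = av231 (rev (word p)).
Proof.
apply/idP/av231P => [/contains3P avp i j k lt_ij lt_jk|avp].
  rewrite size_rev size_word => lt_k.
  rewrite !nth_rev ?size_word; [|lia|lia|lia].
  apply/negP => /andP[lt_ki lt_ij'].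
  have lt_k' : n - k.+1 < n by lia.
  have lt_j' : n - j.+1 < n by lia.
  have lt_i' : n - i.+1 < n by lia.
  apply: avp; exists (Ordinal lt_k'), (Ordinal lt_j'), (Ordinal lt_i').
  move: lt_ki lt_ij'; rewrite -[n - i.+1]/(val (Ordinal lt_i')).
  rewrite -[n - j.+1]/(val (Ordinal lt_j')) -[n - k.+1]/(val (Ordinal lt_k')).
  rewrite !nth_word => lt_ki lt_ij'.
  by split; rewrite /=; lia.
apply/contains3P => -[k [j [i [lt_kj lt_ji]]]] vkj vki vji.
have := avp (n - i.+1) (n - j.+1) (n - k.+1).
have := ltn_ord i; have := ltn_ord j; have := ltn_ord k => lt_k lt_j lt_i.
rewrite size_rev size_word !nth_rev ?size_word; [|lia|lia|lia].
rewrite !subnSK // !subKn; [|lia|lia|lia]; rewrite !nth_word => av.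
have /negP : ~~ ((p k < p i) && (p i < p j)) by apply: av; lia.
by apply; lia.
Qed.

(** The default [x] of [head] makes the last letter contribute no descent. *)
Fixpoint desS (s : seq nat) : nat :=
  if s is x :: s' then (head x s' < x) + desS s' else 0.

Lemma desS_nth w n : size w = n ->
  \sum_(i < n.-1) (nth 0 w i.+1 < nth 0 w i) = desS w.
Proof.
move=> <- {n}; elim: w => [|x [|y s] IH]; rewrite ?big_ord0 //=; first by rewrite ltnn.
by rewrite big_ord_recl; congr (_ + _); rewrite -[RHS]IH.
Qed.

(** The count also visits the neighbour of [x] itself; this is harmless when [B x y y] is false, as
    it is for [in31] and [in13]. *)
Fixpoint st_adj (B : nat -> nat -> pred nat) (s : seq nat) : nat :=
  if s is x :: s' then count (B x (head x s')) s' + st_adj B s' else 0.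

Definition in31 (x y c : nat) : bool := (y < c) && (c < x).
Definition in13 (x y c : nat) : bool := (x < c) && (c < y).

Lemma sum_nth_count (P : pred nat) s :
  \sum_(0 <= j < size s) (P (nth 0 s j) : nat) = count P s.
Proof. by rewrite -(big_nth 0 xpredT (fun c => P c : nat)) -sum1_count [RHS]big_mkcond. Qed.

Lemma st_adj_nth B w n : (forall x y, B x y y = false) -> size w = n ->
  \sum_(i < n.-1) \sum_(i.+2 <= j < n) B (nth 0 w i) (nth 0 w i.+1) (nth 0 w j) =
  st_adj B w.
Proof.
move=> B0 <- {n}; elim: w => [|x [|y s] IH]; rewrite ?big_ord0 //.
rewrite [size _]/= [_.-1]/= big_ord_recl; congr (_ + _).
  by rewrite big_add1 big_add1 /= B0 -sum_nth_count.
by rewrite -[RHS]IH; apply: eq_bigr => i _; rewrite big_add1.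
Qed.

(** Reversal turns descents into ascents and moves the isolated letter from the left of the adjacent
    pair to its right, so 2-31 becomes 13-2. *)
Lemma st_adj_nth_rev w n : size w = n ->
  \sum_(i < n.-1) \sum_(0 <= j < i)
    ((nth 0 (rev w) i.+1 < nth 0 (rev w) j) && (nth 0 (rev w) j < nth 0 (rev w) i)) =
  st_adj in13 w.
Proof.
move=> <- {n}; elim: w => [|x [|y s] IH]; rewrite ?big_ord0 //.
rewrite [size _]/= [_.-1]/= big_ord_recr [LHS]addnC; congr (_ + _).
  rewrite /= [in13 x y y]/in13 ltnn andbF add0n.
  rewrite rev_cons nth_rcons size_rev /= ltnn eqxx rev_cons.
  rewrite -(count_rev _ s) -(size_rev s) -sum_nth_count.
  apply: eq_big_nat => j /andP[_ lt_j].
  by rewrite !nth_rcons !size_rcons lt_j (ltnW lt_j : j < (size (rev s)).+1) ltnSn ltnn eqxx.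
rewrite -[RHS]IH /=; apply: eq_bigr => i _; apply: eq_big_nat => j /andP[_ lt_j].
have lt_i := ltn_ord i.
by rewrite (rev_cons x) !nth_rcons size_rev /= !ltnS lt_i (ltnW lt_i) (ltnW (ltn_trans lt_j lt_i)).
Qed.

Lemma desE n (p : 'S_n) : des p = desS (word p).
Proof. by apply: desS_nth; rewrite size_word. Qed.

Lemma st31_2E n (p : 'S_n) : st31_2 p = st_adj in31 (word p).
Proof.
by apply: (@st_adj_nth in31); rewrite ?size_word // => x y; rewrite /in31 ltnn.
Qed.

Lemma st13_2E n (p : 'S_n) : st13_2 p = st_adj in13 (word p).
Proof.
by apply: (@st_adj_nth in13); rewrite ?size_word // => x y; rewrite /in13 ltnn andbF.
Qed.

Lemma st2_31E n (p : 'S_n) : st2_31 p = st_adj in13 (rev (word p)).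
Proof.
by rewrite -(@st_adj_nth_rev _ n) ?size_rev ?size_word // revK.
Qed.

(* [m] is the running maximum and [B] the value placed after the last letter. *)
Fixpoint coderS (B m : nat) (s : seq nat) : bool :=
  if s is x :: s' then
    ~~ ((m <= x) && (x < head B s')) && coderS B (maxn m x) s'
  else true.

(** The bound by [m] stands for the letters already read, which is what lets the induction on [s] go
    through. *)
Lemma coderSP B m s : reflect
  (forall i, i < size s -> ~ [/\ nth B s i < nth B s i.+1, m <= nth B s i &
     forall j, j <= i -> nth B s j <= nth B s i]) (coderS B m s).
Proof.
elim: s m => [|x s IH] m; first by constructor.
rewrite /=; apply: (iffP andP) => [[not_x /IH cod_s] [|i]|cod].
- move=> _ [/=]; rewrite nth0 => lt_x le_mx _.
  by rewrite lt_x le_mx in not_x.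
- rewrite ltnS => lt_i [/= lt_n le_m le_all]; apply: (cod_s i lt_i); split=> //.
    by rewrite geq_max le_m; apply: (le_all 0).
  by move=> j le_ji; apply: (le_all j.+1).
split.
  apply/negP => /andP[le_mx lt_x]; apply: (cod 0) => //; split=> //=.
  by move=> j; rewrite leqn0 => /eqP ->.
apply/IH => i lt_i [lt_n]; rewrite geq_max => /andP[le_m le_x] le_all.
apply: (cod i.+1) => //; split=> //= -[|j] //; exact: le_all.
Qed.

(** Values start at 0 here, so the closing value is [n]; it enters as the default of [nth]. *)
Lemma coderangementE n (p : 'S_n) : coderangement p = coderS n 0 (word p).
Proof.
have wextE i : wext p i = nth n (word p) i.
  rewrite /wext; case: ltnP => le; last by rewrite nth_default // size_word.
  by apply: set_nth_default; rewrite size_word.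
apply/forallP/coderSP => [cod i|cod i].
  rewrite size_word => lt_i [lt_n _ le_all]; have /negP := cod (Ordinal lt_i).
  apply; rewrite /foremax !wextE lt_n; apply/forallP => j; apply/implyP => le_j.
  by rewrite !wextE le_all.
apply/negP => /andP[]; rewrite !wextE => lt_n /forallP le_all.
apply: (cod i); rewrite ?size_word //; split=> // j le_j.
have lt_j : j < n := leq_ltn_trans le_j (ltn_ord i).
by have /implyP /(_ le_j) := le_all (Ordinal lt_j); rewrite !wextE.
Qed.

(* [b] tells whether the first step is a descent. *)
Fixpoint altS (b : bool) (s : seq nat) : bool :=
  if s is x :: s' then
    (if s' is y :: _ then (y < x) == b else true) && altS (~~ b) s'
  else true.

Lemma altSP b s : reflect
  (forall i, i.+1 < size s -> (nth 0 s i.+1 < nth 0 s i) = b (+) odd i) (altS b s).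
Proof.
elim: s b => [|x [|y s] IH] b; [by constructor | by constructor | ].
rewrite [altS _ _]/=; apply: (iffP andP) => [[/eqP xy /IH alt_s] [|i] lt_i|alt_s].
- by rewrite /= xy addbF.
- by rewrite /= addbN -addNb; apply: alt_s.
split; first by apply/eqP; rewrite (alt_s 0) // addbF.
by apply/IH => i lt_i; rewrite (alt_s i.+1) //= addNb addbN.
Qed.

(** A nonempty up-down word of even length ends with an ascent, so its reverse begins with a
    descent. *)
Lemma alternatingE m (p : 'S_(m.*2)) : alternating p = altS true (rev (word p)).
Proof.
apply/forallP/altSP => [alt_p i|alt_p i].
  rewrite size_rev size_word => lt_i.
  rewrite !nth_rev ?size_word; [|lia|lia].
  have lt_i' : m.*2 - i.+2 < (m.*2).-1 by lia.
  have /eqP := alt_p (Ordinal lt_i'); rewrite /= -subSn // subSS => ->.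
  by rewrite oddB // odd_double /= negbK.
have lt_i := ltn_ord i; have := alt_p (m.*2 - i.+2).
rewrite size_rev size_word !nth_rev ?size_word; [|lia|lia].
have -> : m.*2 - (m.*2 - i.+2).+2 = i by lia.
have -> : m.*2 - (m.*2 - i.+2).+1 = i.+1 by lia.
by move=> ->; [rewrite oddB ?odd_double /= ?negbK; lia | lia].
Qed.

(** * Statistics on trees *)

Definition lnodes t := if t is Node l r then nodes l else 0.
Definition rnodes t := if t is Node l r then nodes r else 0.

Fixpoint desT t :=
  if t is Node l r then (l != Leaf) + desT l + desT r else 0.
(** A node creates one descent, from its label to the root of a nonempty [l]; the later letters in
    between are the right subtree of [l]. *)
Fixpoint st31T t :=
  if t is Node l r then rnodes l + st31T l + st31T r else 0.
(** The ascent into [r] starts below all of [r], so it encloses exactly the letters of [r] below its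
    root, that is, its left subtree. *)
Fixpoint st13T t :=
  if t is Node l r then st13T l + (lnodes r + st13T r) else 0.
(** The left-to-right maxima are the labels of the right spine; such a label is followed by a
    smaller letter exactly when its left subtree is nonempty. *)
Fixpoint coderT t :=
  if t is Node l r then (l != Leaf) && coderT r else true.

Lemma count_all (T : eqType) (P : pred T) s : {in s, forall x, P x} -> count P s = size s.
Proof. by move=> /allP; rewrite all_count => /eqP. Qed.

Lemma count_none (T : eqType) (P : pred T) s : {in s, forall x, ~~ P x} -> count P s = 0.
Proof. by move=> s_P; apply/eqP; rewrite -leqn0 leqNgt -has_count; apply/hasPn. Qed.

Lemma st_adj_cons B y z s :
  st_adj B [:: y, z & s] = count (B y z) (z :: s) + st_adj B (z :: s).
Proof. by []. Qed.

Lemma altS_cons b y z s :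
  altS b [:: y, z & s] = ((z < y) == b) && altS (~~ b) (z :: s).
Proof. by []. Qed.

(** * Concatenation of a low word and a high word *)

Section Separated.
Variables (x : nat) (v : seq nat).
Hypothesis v_gt : {in v, forall c, x < c}.

Lemma desS_cat u : {in u, forall c, c <= x} -> desS (u ++ v) = desS u + desS v.
Proof.
elim: u => [//|y u IH] u_le /=; rewrite IH ?addnA; last first.
  by move=> c c_u; apply: u_le; rewrite inE c_u orbT.
case: u {IH} u_le => [|z u] //= u_le; rewrite ltnn addn0.
case: v v_gt => [|c v' /(_ c (mem_head _ _)) lt_xc] /=; first by rewrite ltnn.
have := u_le y (mem_head _ _); lia.
Qed.

Lemma st31_cat u : {in u, forall c, c <= x} ->
  st_adj in31 (u ++ v) = st_adj in31 u + st_adj in31 v.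
Proof.
elim: u => [//|y u IH] u_le /=; rewrite IH ?addnA; last first.
  by move=> c c_u; apply: u_le; rewrite inE c_u orbT.
rewrite count_cat; have le_yx := u_le y (mem_head _ _).
have -> z : count (in31 y z) v = 0.
  by apply: count_none => c /v_gt lt_xc; rewrite /in31; lia.
by rewrite addn0; case: u {IH u_le}.
Qed.

(** The last low letter lies below all of [v], so the ascent across the cut encloses the letters of
    [v] below its head; pairs inside the low part enclose no letter of [v]. *)
Lemma st13_cat y u : {in y :: u, forall c, c <= x} ->
  st_adj in13 ((y :: u) ++ v) =
  st_adj in13 (y :: u) + (count (fun c => c < head 0 v) v + st_adj in13 v).
Proof.
elim: u y => [|z u IH] y u_le.
  rewrite /= !add0n; congr (_ + _); have le_yx := u_le y (mem_head _ _).
  case: v v_gt => [//|c v'] v'_gt; apply: eq_in_count => d /v'_gt lt_xd.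
  by rewrite /in13 /=; lia.
rewrite !cat_cons st_adj_cons -cat_cons count_cat IH; last first.
  by move=> c c_u; apply: u_le; rewrite inE c_u orbT.
have -> : count (in13 y z) v = 0.
  apply: count_none => c /v_gt lt_xc.
  by have := u_le z; rewrite !inE eqxx orbT /in13 => /(_ isT); lia.
by rewrite st_adj_cons addn0 !addnA.
Qed.

Lemma coder_cat B u : {in u, forall c, c < x} -> coderS B x (u ++ v) = coderS B x v.
Proof.
elim: u => [//|y u IH] u_lt /=; have lt_yx := u_lt y (mem_head _ _).
rewrite (maxn_idPl (ltnW lt_yx)) IH; last first.
  by move=> c c_u; apply: u_lt; rewrite inE c_u orbT.
by rewrite leqNgt lt_yx.
Qed.

(** The step across the cut has index [size u] and is an ascent, which fixes a parity; the following
    step must be a descent. *)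
Lemma altS_cat b y u : {in y :: u, forall c, c <= x} ->
  altS b ((y :: u) ++ v) =
  altS b (y :: u) && ((v == [::]) || (b == odd (size u)) && altS true v).
Proof.
elim: u b y => [|z u IH] b y u_le.
  have le_yx := u_le y (mem_head _ _).
  case: v v_gt => [_|c v' /(_ c (mem_head _ _)) /= lt_xc]; first by [].
  have -> : (c < y) = false by lia.
  by case: b.
rewrite !cat_cons altS_cons -cat_cons IH; last by move=> c c_u; apply: u_le; rewrite inE c_u orbT.
rewrite [altS b _]altS_cons -!andbA; do 2 congr (_ && _).
by rewrite /=; case: b; case: (odd _).
Qed.

End Separated.

Lemma head_tword o l r B : head B (tword o (Node l r)) = o + nodes l.
Proof. by []. Qed.

Section TwordNode.
Variables (o : nat) (l r : tree).
Let x := o + nodes l.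

Lemma tword_node_le : {in x :: tword o l, forall c, c <= x}.
Proof. by move=> c; rewrite inE mem_tword /x; lia. Qed.

Lemma tword_node_lt : {in tword o l, forall c, c < x}.
Proof. by move=> c; rewrite mem_tword /x; lia. Qed.

Lemma tword_node_gt : {in tword x.+1 r, forall c, x < c}.
Proof. by move=> c; rewrite mem_tword; lia. Qed.

Lemma tword_nodeE : tword o (Node l r) = (x :: tword o l) ++ tword x.+1 r.
Proof. by []. Qed.
End TwordNode.

Lemma desS_tword o t : desS (tword o t) = desT t.
Proof.
elim: t o => [//|l IHl r IHr] o.
rewrite tword_nodeE (desS_cat (@tword_node_gt o l r) (@tword_node_le o l)) IHr.
rewrite /= IHl; congr (_ + _ + _); case: l {IHl} => [|a b] /=; first by rewrite ltnn.
by rewrite -addSn; lia.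
Qed.

Lemma st31_tword o t : st_adj in31 (tword o t) = st31T t.
Proof.
elim: t o => [//|l IHl r IHr] o.
rewrite tword_nodeE (st31_cat (@tword_node_gt o l r) (@tword_node_le o l)) IHr.
rewrite /= IHl; congr (_ + _ + _); case: l {IHl} => [|a b] //.
rewrite head_tword tword_nodeE count_cat [count _ (_ :: _)]/=.
rewrite [count _ (tword _ b)]count_all ?size_tword; last first.
  by move=> c; rewrite mem_tword /in31 /=; lia.
rewrite count_none; last by move=> c; rewrite mem_tword /in31 /=; lia.
by rewrite /in31 ltnn.
Qed.

Lemma count_head_tword o t : count (fun c => c < head 0 (tword o t)) (tword o t) = lnodes t.
Proof.
case: t => [//|l r]; rewrite head_tword tword_nodeE count_cat [count _ (_ :: _)]/=.
rewrite [count _ (tword _ l)]count_all ?size_tword; last first.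
  by move=> c; rewrite mem_tword /=; lia.
rewrite count_none; last by move=> c; rewrite mem_tword /=; lia.
by rewrite ltnn addn0.
Qed.

Lemma st13_tword o t : st_adj in13 (tword o t) = st13T t.
Proof.
elim: t o => [//|l IHl r IHr] o.
rewrite tword_nodeE (st13_cat (@tword_node_gt o l r) (@tword_node_le o l)) IHr.
rewrite count_head_tword /= IHl; congr (_ + _).
rewrite count_none // => c; rewrite mem_tword /in13.
by case: l {IHl} => [|a b] /=; lia.
Qed.

Lemma coderS_tword B m o t : m <= o -> o + nodes t <= B -> coderS B m (tword o t) = coderT t.
Proof.
elim: t m o => [//|l _ r IHr] m o le_mo; rewrite [nodes _]/= => le_B.
rewrite [LHS]/= (maxn_idPr _); last by lia.
rewrite (coder_cat (x := o + nodes l)); last exact: tword_node_lt.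
rewrite IHr; [|lia|lia]; congr (_ && _).
have -> : m <= o + nodes l by lia.
(* With [l] empty, the next letter is the head of [r] or the closing value [B], and both exceed the
   label. *)
by case: l le_B => [|a b] /=; [case: r {IHr} => [|a b] /= |]; lia.
Qed.

(** A nonempty [l] makes the first step a descent, which requires [b]; the step into [r] has index
    [nodes l]. *)
Fixpoint altT b t :=
  if t is Node l r then
    ((l == Leaf) || b && altT (~~ b) l) &&
    ((r == Leaf) || (b == odd (nodes l)) && altT true r)
  else true.

Lemma altS_tword b o t : altS b (tword o t) = altT b t.
Proof.
elim: t b o => [//|l IHl r IHr] b o.
rewrite tword_nodeE (altS_cat (@tword_node_gt o l r) _ (@tword_node_le o l)) IHr.
rewrite size_tword /=; congr (_ && (_ || _)); last by case: (r).
rewrite IHl; case: l {IHl} => [|a b'] //=.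
by have -> : o + nodes a < o + (nodes a + nodes b').+1 by lia.
Qed.

Definition downup t := altT true t && ~~ odd (nodes t).
Definition updown t := altT false t && odd (nodes t).

(** The ascent into [r], or the even total size when [r] is empty, forces [l] to have odd size; [l]
    begins with an ascent because the root was followed by a descent. *)
Lemma downup_node l r : downup (Node l r) = updown l && downup r.
Proof.
rewrite /downup /updown /= oddD negbK.
case: (l =P Leaf) => [->|_]; case: (r =P Leaf) => [->|_] /=; rewrite ?addbF //.
all: by case: (odd (nodes l)); case: (odd (nodes r)); case: (altT false l); case: (altT true r).
Qed.

Lemma updown_node l r : updown (Node l r) = (l == Leaf) && downup r.
Proof.
by rewrite /downup /updown /=; case: l => [|a b] //=; case: r.
Qed.

Local Open Scope ring_scope.

(** * Truncated power series *)

Definition conv (R : comNzRingType) (f g : nat -> R) (n : nat) : R :=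
  \sum_(k < n.+1) f k * g (n - k)%N.

Section TruncatedSeries.
Variables (R : comNzRingType) (N : nat).
Implicit Types f g h : nat -> R.

(** Power series are taken modulo z^(N+1): the quotient is a commutative ring where [ring] applies,
    and [tseriesP] returns to the coefficients up to [N]. *)
Definition tseries f : {poly %/ ('X^(N.+1) : {poly R})} :=
  in_qpoly 'X^(N.+1) (\poly_(i < N.+1) f i).

Definition tX : {poly %/ ('X^(N.+1) : {poly R})} := in_qpoly 'X^(N.+1) 'X.
Definition tC (c : R) : {poly %/ ('X^(N.+1) : {poly R})} := in_qpoly 'X^(N.+1) c%:P.

Lemma in_qpolyXnP (p r : {poly R}) :
  in_qpoly 'X^(N.+1) p = in_qpoly 'X^(N.+1) r <->
  (forall i, (i <= N)%N -> p`_i = r`_i).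
Proof.
have val_in (s : {poly R}) : in_qpoly 'X^(N.+1) s = take_poly N.+1 s :> {poly R}.
  by rewrite /= mk_monic_Xn Pdiv.RingMonic.take_poly_rmodp.
split=> [eq_pr i le_iN | eq_pr].
  have eq_take : take_poly N.+1 p = take_poly N.+1 r by rewrite -!val_in eq_pr.
  by have := congr1 (fun s : {poly R} => s`_i) eq_take; rewrite !coef_take_poly ltnS le_iN.
apply/val_inj; rewrite [LHS]val_in [RHS]val_in; apply/polyP=> i.
by rewrite !coef_take_poly ltnS; case: ifP => // /eq_pr.
Qed.

Lemma tseriesP f g : tseries f = tseries g <-> (forall i, (i <= N)%N -> f i = g i).
Proof.
rewrite in_qpolyXnP; split=> eq_fg i le_iN; have := eq_fg i le_iN;
  by rewrite !coef_poly ltnS le_iN.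
Qed.

(** Turns a recurrence on coefficients into the functional equation F = f(0) + z G H. *)
Lemma tseries_rec f g h : (forall n, f n.+1 = conv g h n) ->
  tseries f = tC (f 0%N) + tX * (tseries g * tseries h).
Proof.
move=> fE; rewrite /tseries /tC /tX -[X in _ + _ * X]in_qpolyM -in_qpolyM -in_qpolyD; apply/in_qpolyXnP.
move=> [|i] le_iN; rewrite coef_poly coefD coefXM coefC ltnS le_iN /= ?addr0 // add0r.
rewrite fE coefM; apply: eq_bigr => k _.
have le_kN : (k < N.+1)%N by case: k => /= k; lia.
have le_ikN : (i - k < N.+1)%N by lia.
by rewrite !coef_poly le_kN le_ikN.
Qed.

Lemma tseriesD f g : tseries (fun i => f i + g i) = tseries f + tseries g.
Proof.
rewrite /tseries -in_qpolyD; apply/in_qpolyXnP => i le_iN.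
by rewrite coefD !coef_poly ltnS le_iN.
Qed.

Lemma tseriesZ c f : tseries (fun i => c * f i) = tC c * tseries f.
Proof.
rewrite /tseries /tC -in_qpolyM; apply/in_qpolyXnP => i le_iN.
by rewrite coefCM !coef_poly ltnS le_iN.
Qed.

Lemma tseriesN f : tseries (fun i => - f i) = - tseries f.
Proof.
rewrite /tseries -rmorphN; apply/in_qpolyXnP => i le_iN.
by rewrite coefN !coef_poly ltnS le_iN.
Qed.

Lemma tseries_shift f g :
  f 0%N = 0 -> (forall n, f n.+1 = g n) -> tseries f = tX * tseries g.
Proof.
move=> f0 fE; rewrite /tseries /tX -in_qpolyM; apply/in_qpolyXnP => i le_iN.
rewrite coefXM !coef_poly ltnS le_iN; case: i le_iN => [//|i] lt_iN /=.
by rewrite fE ltnS (ltnW lt_iN).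
Qed.

(** The factor z pushes the coefficient of degree [N] out of range, so an induction hypothesis below
    [N] suffices inside an equation modulo z^(N+1). *)
Lemma tX_eq f g : (forall i, (i < N)%N -> f i = g i) ->
  tX * tseries f = tX * tseries g.
Proof.
move=> eq_fg; rewrite /tseries /tX -!in_qpolyM; apply/in_qpolyXnP => i le_iN.
rewrite !coefXM !coef_poly; case: i le_iN => [//|i] lt_iN /=.
by rewrite ltnS (ltnW lt_iN) eq_fg.
Qed.

Lemma tseries1 : tseries (fun i => (i == 0%N)%:R) = 1.
Proof.
rewrite /tseries -(rmorph1 (in_qpoly ('X^(N.+1) : {poly R}))).
apply/in_qpolyXnP => i le_iN.
by rewrite coef1 coef_poly ltnS le_iN.
Qed.

Lemma tC1 : tC 1 = 1.
Proof. exact: rmorph1. Qed.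
Lemma tC0 : tC 0 = 0.
Proof. exact: rmorph0. Qed.
Lemma tCN c : tC (- c) = - tC c.
Proof. by rewrite /tC -rmorphN polyCN. Qed.
End TruncatedSeries.

(** * Convolution and the substitution of qz for z *)

Section Convolution.
Variable R : comNzRingType.
Implicit Types (f g h : nat -> R) (c q : R).

Lemma eq_conv f f' g g' n : (forall i, (i <= n)%N -> f i = f' i) ->
  (forall i, (i <= n)%N -> g i = g' i) -> conv f g n = conv f' g' n.
Proof.
move=> eq_f eq_g; apply: eq_bigr => k _.
by rewrite eq_f ?eq_g ?leq_subr // -ltnS.
Qed.

Lemma conv_shift f g h n : f 0%N = 0 -> (forall k, f k.+1 = h k) ->
  conv f g n.+1 = conv h g n.
Proof.
move=> f0 fE; rewrite /conv big_ord_recl f0 mul0r add0r.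
by apply: eq_bigr => k _; rewrite fE.
Qed.

Lemma convZl c f g n : conv (fun k => c * f k) g n = c * conv f g n.
Proof. by rewrite /conv big_distrr /=; apply: eq_bigr => k _; rewrite mulrA. Qed.

Definition qscale q f (k : nat) : R := q ^+ k * f k.

Lemma conv_qscale q f g n :
  conv (qscale q f) (qscale q g) n = q ^+ n * conv f g n.
Proof.
rewrite /conv big_distrr /=; apply: eq_bigr => k _; rewrite /qscale.
have -> : q ^+ n = q ^+ k * q ^+ (n - k) by rewrite -exprD subnKC // -ltnS.
by rewrite !mulrA; congr (_ * _); rewrite -!mulrA; congr (_ * _); rewrite mulrC.
Qed.

(** Substitutes qz for z in F = A + z B C. The work is done on coefficients, with [h] holding those
    of z B C. *)
Lemma tseries_qscale N q f a b (c : nat -> R) :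
  tseries N f = tseries N a + tX R N * (tseries N b * tseries N c) ->
  tseries N (qscale q f) = tseries N (qscale q a) +
    tC N q * tX R N * (tseries N (qscale q b) * tseries N (qscale q c)).
Proof.
pose h b' (c' : nat -> R) (k : nat) : R := if k is k'.+1 then conv b' c' k' else 0.
have hE b' (c' : nat -> R) : tseries N (h b' c') = tX R N * (tseries N b' * tseries N c').
  by rewrite (@tseries_rec _ _ _ b' c') // tC0 add0r.
rewrite -mulrA -!hE -tseriesZ -!tseriesD => /tseriesP eq_f.
apply/tseriesP=> i le_iN; rewrite {1}/qscale eq_f // mulrDr; congr (_ + _).
by case: i {le_iN} => [|i] /=; rewrite ?mulr0 // conv_qscale exprS mulrA.
Qed.

Definition scons c f (k : nat) : R := if k is k'.+1 then f k' else c.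

Lemma tseries_scons N c f : tseries N (scons c f) = tC N c + tX R N * tseries N f.
Proof.
rewrite -(@tseries_shift _ _ (scons 0 f)) // -[tC N c]mulr1 -(tseries1 R N).
rewrite -tseriesZ -tseriesD; apply/tseriesP => -[|i] _ /=.
  by rewrite mulr1 addr0.
by rewrite mulr0 add0r.
Qed.

Lemma tseries_qscale_scons N q c f : tseries N (qscale q (scons c f)) =
  tC N c + tC N q * tX R N * tseries N (qscale q f).
Proof.
rewrite [tC N q * _]mulrC -mulrA -tseriesZ -tseries_scons.
apply/tseriesP => -[|i] _; rewrite /qscale /= ?expr0 ?mul1r //.
by rewrite exprS mulrA.
Qed.

End Convolution.

(* The coefficients of the even series with A(z) = 1 - q z^2 A(qz) A(z). *)
Definition qcat_spec (R : comNzRingType) (q : R) (a : nat -> R) :=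
  [/\ a 0%N = 1, a 1%N = 0 & forall n, a n.+2 = - q * conv (qscale q a) a n].

Lemma qcat_spec_unique (R : comNzRingType) (q : R) a b :
  qcat_spec q a -> qcat_spec q b -> a =1 b.
Proof.
move=> [a0 a1 aE] [b0 b1 bE] n.
elim/ltn_ind: n => [[|[|n]]] IH; rewrite ?a0 ?a1 // aE bE; congr (_ * _).
by apply: eq_conv => i le_in; rewrite /qscale IH // ltnS leqW.
Qed.

(* [u] is a combination of relations that vanish, and [x - y = u] is left to [ring]. *)
Lemma eq_of_subr0 (K : comNzRingType) (x y u : K) : u = 0 -> x - y = u -> x = y.
Proof. by move=> -> /eqP; rewrite subr_eq0 => /eqP. Qed.

(** * Solving the functional equations *)

Section SeriesIdentities.
Variables (R : comNzRingType) (q : R) (a : nat -> R).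
Hypothesis a_spec : qcat_spec q a.

Let a_rec N :
  tseries N a = 1 - tC N q * tX R N ^+ 2 * tseries N (qscale q a) * tseries N a.
Proof.
case: a_spec => a0 a1 aE /=.
(* The two-step recurrence becomes a one-step one with - q z A(qz) as the first factor. *)
rewrite [LHS](@tseries_rec _ _ _ (scons 0 (fun k => - q * qscale q a k)) a) => [|[|n]].
- by rewrite tseries_scons tseriesZ tCN a0 tC1 tC0; ring.
- by rewrite /conv big_ord_recl big_ord0 mul0r addr0.
- by rewrite (@conv_shift _ _ _ (fun k => - q * qscale q a k)) // convZl.
Qed.

(** By induction F(qz) = 1 + qz A(qz) below degree [N]. Then 1/E = 1 + z + q z^2 A(qz) = z + 1/A, so
    E = A/(1 + zA) and F = 1/(1 - zE) = 1 + zA. *)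
Lemma des_st31_series f e : f 0%N = 1 -> e 0%N = 1 ->
  (forall n, f n.+1 = conv e f n) ->
  (forall n, e n.+1 = -1 * conv e (qscale q f) n) ->
  f =1 scons 1 a.
Proof.
move=> f0 e0 fE eE N; elim/ltn_ind: N => N IH.
suff eq_N : tseries N f = tseries N (scons 1 a) by move/tseriesP: eq_N => ->.
have hF := tseries_rec N fE; rewrite f0 in hF.
have eE' n : e n.+1 = conv (fun k => -1 * e k) (qscale q f) n by rewrite eE convZl.
have hE := tseries_rec N eE'; rewrite e0 tseriesZ in hE.
have hf : tX R N * tseries N (qscale q f) =
    tX R N * (tC N 1 + tC N q * tX R N * tseries N (qscale q a)).
  rewrite -tseries_qscale_scons; apply: tX_eq => i lt_iN.
  by rewrite /qscale IH.
have := a_rec N; rewrite tseries_scons.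
move: (tseries N f) (tseries N (qscale q f)) (tseries N e) (tseries N a)
  (tseries N (qscale q a)) (tC N q) (tX R N) hF hE hf => F Fq E A Aq Q z.
rewrite tCN tC1 => hF hE hf hA.
(* Cross-multiplying the equations of E and A eliminates A(qz). *)
have hEA : E = A - z * A * E.
  have hE' : E = 1 - E * (z * (1 + Q * z * Aq)) by rewrite {1}hE -hf; ring.
  apply: (@eq_of_subr0 _ _ _ (E * (1 - Q * z ^+ 2 * Aq * A - A) +
                          A * (E - (1 - E * (z * (1 + Q * z * Aq)))))).
    by rewrite -hA -hE' !subrr !mulr0 addr0.
  by ring.
apply: (@eq_of_subr0 _ _ _ ((F - (1 + z * (E * F))) * (1 + z * A) +
                        z * F * (E - (A - z * A * E)))).
  by rewrite -hF -hEA !subrr mulr0 mul0r addr0.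
by ring.
Qed.

(** Here P = 2 - F, and by induction P(qz) = 1 - qz A(qz) below degree [N]. Then 1/W = 1/A - z, and
    solving F = 1 + z (2 - F) W gives 1 + zA. *)
Lemma des_st13_series f p w : f 0%N = 1 -> w 0%N = 1 -> p =1 scons 1 (fun k => - f k.+1) ->
  (forall n, f n.+1 = conv p w n) ->
  (forall n, w n.+1 = conv (qscale q p) w n) ->
  f =1 scons 1 a.
Proof.
move=> f0 w0 pE fE wE N; elim/ltn_ind: N => N IH.
suff eq_N : tseries N f = tseries N (scons 1 a) by move/tseriesP: eq_N => ->.
have hP : tseries N p = 2 - tseries N f.
  have -> : tseries N p =
      tseries N (fun k => (k == 0%N)%:R + (k == 0%N)%:R + -1 * f k).
    by apply/tseriesP => -[|k] _; rewrite pE /= ?f0; ring.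
  by rewrite !tseriesD tseriesZ tCN tC1 tseries1; ring.
have hPq : tX R N * tseries N (qscale q p) =
    tX R N * (tC N 1 - tC N q * tX R N * tseries N (qscale q a)).
  have -> : - (tC N q * tX R N * tseries N (qscale q a)) =
      tC N q * tX R N * tseries N (qscale q (fun k => - a k)).
    rewrite -mulrN -tseriesN; congr (_ * _); apply/tseriesP => i _.
    by rewrite /qscale mulrN.
  rewrite -tseries_qscale_scons; apply: tX_eq => -[|i] lt_iN.
    by rewrite /qscale pE.
  by rewrite /qscale pE /= IH.
have hF := tseries_rec N fE; rewrite f0 in hF.
have hW := tseries_rec N wE; rewrite w0 in hW.
have := a_rec N; rewrite tseries_scons.
rewrite mulrA hPq in hW; rewrite hP in hF.
move: (tseries N f) (tseries N w) (tseries N a)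
  (tseries N (qscale q a)) (tC N q) (tX R N) hF hW => F W A Aq Q z.
rewrite tC1 => hF hW hA.
have hWA : W = A + z * A * W.
  apply: (@eq_of_subr0 _ _ _ (A * (W - (1 + z * (1 - Q * z * Aq) * W)) +
                          W * (1 - Q * z ^+ 2 * Aq * A - A))).
    by rewrite -hA -hW !subrr !mulr0 addr0.
  by ring.
apply: (@eq_of_subr0 _ _ _ ((F - (1 + z * ((2 - F) * W))) * (1 - z * A) +
                        z * (2 - F) * (W - (A + z * A * W)))).
  by rewrite -hF -hWA !subrr mulr0 mul0r addr0.
by ring.
Qed.

(** First E = 1 - qz A(qz) by induction: below degree [N] it gives 1/F = 1/A - z, hence F(qz), hence
    the next coefficient of E. Then D = 1/(1 - z(E - 1)) = 1/(1 + q z^2 A(qz)) = A. *)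
Lemma coder_st31_series f e d : f 0%N = 1 -> e 0%N = 1 -> d 0%N = 1 ->
  (forall n, f n.+1 = conv e f n) ->
  (forall n, e n.+1 = - q * conv e (qscale q f) n) ->
  (forall n, d n.+1 = conv (scons 0 (fun k => e k.+1)) d n) ->
  d =1 a.
Proof.
move=> f0 e0 d0 fE eE dE.
have eqe N : e N = scons 1 (fun k => - q * qscale q a k) N.
  elim/ltn_ind: N => N IH.
  suff eq_N : tseries N e = tseries N (scons 1 (fun k => - q * qscale q a k)) by move/tseriesP: eq_N => ->.
  have hF := tseries_rec N fE; rewrite f0 in hF.
  have he : tX R N * tseries N e =
      tX R N * (tC N 1 + tX R N * (tC N (- q) * tseries N (qscale q a))).
    by rewrite -tseriesZ -tseries_scons; apply: tX_eq.
  have hFA : tseries N f = tseries N a + tX R N * (tseries N a * tseries N f).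
    have := a_rec N; rewrite mulrA he in hF.
    move: (tseries N f) (tseries N a) (tseries N (qscale q a)) (tX R N) hF => F A Aq z.
    rewrite tCN tC1; move: (tC N q) => Q hF hA.
    apply: (@eq_of_subr0 _ _ _ (A * (F - (1 + z * (1 + z * (- Q * Aq)) * F)) +
                          F * (1 - Q * z ^+ 2 * Aq * A - A))).
      by rewrite -hA -hF !subrr !mulr0 addr0.
    by ring.
  have hFq := tseries_qscale q hFA.
  have eE' n : e n.+1 = conv (fun k => - q * e k) (qscale q f) n by rewrite eE convZl.
  have hE := tseries_rec N eE'; rewrite e0 tseriesZ in hE.
  rewrite tseries_scons tseriesZ.
  move: (tseries N (qscale q f)) (tseries N e) (tseries N (qscale q a)) (tX R N) hFq hE.
  rewrite tCN tC1; move: (tC N q) => Q Fq E Aq z hFq hE.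
  apply: (@eq_of_subr0 _ _ _ ((E - (1 + z * (- Q * E * Fq))) * (1 - Q * z * Aq) -
                           Q * z * E * (Fq - (Aq + Q * z * (Aq * Fq))))).
    by rewrite -hE -hFq !subrr mulr0 mul0r subr0.
  by ring.
have dE' n : d n.+1 = conv (scons 0 (fun k => - q * qscale q a k)) d n.
  by rewrite dE; apply: eq_conv => // -[|i] _ //=; rewrite eqe.
move=> N; suff eq_N : tseries N d = tseries N a by move/tseriesP: eq_N => ->.
have := a_rec N; have := tseries_rec N dE'.
rewrite d0 tseries_scons tseriesZ tC0 tCN tC1.
move: (tseries N d) (tseries N a) (tseries N (qscale q a)) (tX R N) (tC N q).
move=> D A Aq z Q hD hA.
apply: (@eq_of_subr0 _ _ _ (A * (D - (1 + z * ((0 + z * (- Q * Aq)) * D))) +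
                        D * (1 - Q * z ^+ 2 * Aq * A - A))).
  by rewrite -hA -hD !subrr !mulr0 addr0.
by ring.
Qed.

(** V satisfies V = 1 - q z^2 A(qz) V, the equation of A, so V = A; beyond its constant term D is
    then - z^2 A^2. *)
Lemma coder_st13_series v d : v 0%N = 1 ->
  (forall n, d n.+1 = conv (scons 0 (fun k => - a k)) v n) ->
  (forall n, v n.+1 = conv (qscale q (scons 0 (fun k => - a k))) v n) ->
  d 1%N = 0 /\ forall n, d n.+2 = - conv a a n.
Proof.
move=> v0 dE vE.
have [a0 a1 aE] := a_spec.
have va : v =1 a.
  move=> n; elim/ltn_ind: n => [[|[|n]]] IH; first by rewrite v0.
    by rewrite vE /conv big_ord_recl big_ord0 /qscale /= mulr0 mul0r addr0.
  rewrite vE aE (@conv_shift _ _ _ (fun k => - q * qscale q a k)) /qscale //=.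
  - rewrite convZl; congr (_ * _); apply: eq_conv => // i le_in.
    by rewrite IH // ltnS leqW.
  - by rewrite mulr0.
  - by move=> k; rewrite exprS; ring.
split=> [|n]; first by rewrite dE /conv big_ord_recl big_ord0 mul0r addr0.
rewrite dE (@conv_shift _ _ _ (fun k => -1 * a k)) //; last first.
  by move=> k; rewrite /= mulN1r.
by rewrite convZl mulN1r; congr (- _); apply: eq_conv.
Qed.
End SeriesIdentities.

(** * The continued fraction and the even series A *)

Lemma sum_even_support (R : comNzRingType) (F : nat -> R) m :
  (forall k, odd k -> F k = 0) ->
  \sum_(k < m.*2.+1) F k = \sum_(j < m.+1) F j.*2.
Proof.
move=> F0; elim: m => [|m IH]; first by rewrite !big_ord_recl !big_ord0.
rewrite doubleS big_ord_recr /= big_ord_recr /= IH [RHS]big_ord_recr /=.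
by rewrite F0 ?addr0 //= odd_double.
Qed.

Lemma size_cf_coeffs (R : comNzRingType) (c : nat -> R) m k :
  size (cf_coeffs c m k) = m.+1.
Proof. by elim: m k => [//|m IH] k /=; rewrite size_rcons IH. Qed.

Lemma nth_cf_coeffs (R : comNzRingType) (c : nat -> R) m k i : (i <= m)%N ->
  (cf_coeffs c m k)`_i = (cf_coeffs c i k)`_i.
Proof.
elim: m => [|m IH]; first by rewrite leqn0 => /eqP ->.
rewrite leq_eqVlt => /orP[/eqP -> //|lt_im].
by rewrite /= nth_rcons size_cf_coeffs lt_im IH.
Qed.

Lemma cf_coeffsS (R : comNzRingType) (c : nat -> R) n k :
  (cf_coeffs c n.+1 k)`_n.+1 =
  c k * conv (fun i => (cf_coeffs c i k.+1)`_i) (fun i => (cf_coeffs c i k)`_i) n.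
Proof.
rewrite /= nth_rcons size_cf_coeffs ltnn eqxx; congr (_ * _).
apply: eq_bigr => i _; rewrite !(@nth_cf_coeffs _ _ n) ?leq_subr //.
by rewrite -ltnS.
Qed.

Lemma Ccoef_sqr (R : comNzRingType) (p : R) j : Ccoef p (p ^+ 2) j = p ^+ j.
Proof.
rewrite /Ccoef -exprM -[in RHS](odd_double_half j) exprD -muln2 mulnC.
by case: (odd j).
Qed.

(* For C_n(q, q^2) the j-th coefficient is q^j, so the k-th tail of the continued
   fraction is the whole fraction with z replaced by q^k z. *)
Lemma cf_coeffs_geom (R : comNzRingType) (p : R) n k :
  (cf_coeffs (Ccoef p (p ^+ 2)) n k)`_n = p ^+ (k * n) * Cq p n.
Proof.
elim/ltn_ind: n k => [[|n]] IH k; first by rewrite muln0 mul1r.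
rewrite /Cq /Ctq /cf_coef !cf_coeffsS !Ccoef_sqr expr0 mul1r.
rewrite mulnS exprD -mulrA; congr (_ * _).
rewrite /conv big_distrr /=; apply: eq_bigr => i _.
rewrite !IH; try by case: i => /= i; lia.
rewrite mul1n mul0n expr0 mul1r /Cq /Ctq /cf_coef.
have -> : (k * n = k * i + k * (n - i))%N by case: i => /= i; nia.
by rewrite mulSn !exprD; ring.
Qed.

Lemma Cq0 (R : comNzRingType) (p : R) : Cq p 0 = 1.
Proof. by []. Qed.

(** The first tail of the fraction is C(pz), whence C(z) = 1 + z C(pz) C(z). *)
Lemma CqS (R : comNzRingType) (p : R) n :
  Cq p n.+1 = conv (qscale p (Cq p)) (Cq p) n.
Proof.
rewrite /Cq /Ctq /cf_coef cf_coeffsS Ccoef_sqr expr0 mul1r.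
by apply: eq_conv => i _; rewrite cf_coeffs_geom ?mul1n // mul1r.
Qed.

Definition qcat_even (R : comNzRingType) (q : R) (n : nat) : R :=
  if odd n then 0 else (- q) ^+ n./2 * Cq (q ^+ 2) n./2.

(** The factor (q^2)^j from [CqS] at base q^2 is the scaling q^k at the even index k = 2j. *)
Lemma qcat_even_spec (R : comNzRingType) (q : R) : qcat_spec q (qcat_even q).
Proof.
split=> // [|n]; first by rewrite /qcat_even /= mul1r Cq0.
rewrite {1}/qcat_even /= negbK; case: ifP => odd_n.
  (* For odd [n], one of [k] and [n - k] is odd in every term. *)
  rewrite /conv big1 ?mulr0 // => k _; rewrite /qscale /qcat_even.
  rewrite oddB; last by rewrite -ltnS.
  rewrite odd_n.
  by case: (odd k); rewrite /= ?mulr0 ?mul0r.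
have [m ->] : exists m, n = m.*2.
  by exists n./2; rewrite -[LHS]odd_double_half odd_n.
rewrite doubleK /conv (@sum_even_support _
  (fun k => qscale q (qcat_even q) k * qcat_even q (m.*2 - k))); last first.
  by move=> k odd_k; rewrite /qscale /qcat_even odd_k mulr0 mul0r.
rewrite CqS exprS -mulrA; congr (_ * _); rewrite /conv big_distrr /=.
apply: eq_bigr => j _; rewrite /qscale /qcat_even -doubleB !odd_double !doubleK.
have -> : (- q) ^+ m = (- q) ^+ j * (- q) ^+ (m - j) by rewrite -exprD subnKC // -ltnS.
by rewrite -mul2n exprM; ring.
Qed.

(** * Replacing z^2 by -z^2 *)

Section SignTwist.
Variable R : comNzRingType.

Definition sgn2 (f : nat -> R) (n : nat) : R := (-1) ^+ n./2 * f n.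

Lemma conv_sgn2 (f g : nat -> R) n : (forall k, odd k -> f k = 0) ->
  conv (sgn2 f) (sgn2 g) n = (-1) ^+ n./2 * conv f g n.
Proof.
move=> f0; rewrite /conv big_distrr /=; apply: eq_bigr => k _; rewrite /sgn2.
case odd_k: (odd k); first by rewrite f0 // !(mulr0, mul0r).
have -> : n./2 = (k./2 + (n - k)./2)%N by case: k odd_k => /= k; lia.
by rewrite exprD; ring.
Qed.

(** Steps of two starting from [b 1 = 0] kill the odd coefficients; each such step changes the sign,
    turning the factor q into -q. *)
Lemma qcat_spec_sgn2 (q : R) b : b 0%N = 1 -> b 1%N = 0 ->
  (forall n, b n.+2 = q * conv (qscale q b) b n) ->
  (forall k, odd k -> b k = 0) /\ qcat_spec q (sgn2 b).
Proof.
move=> b0 b1 bE.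
have b_odd k : odd k -> b k = 0.
  elim/ltn_ind: k => [[|[|k]]] IH //=; rewrite negbK => odd_k.
  rewrite bE /conv big1 ?mulr0 // => i _; have := ltn_ord i; rewrite ltnS => le_ik.
  have [odd_i|even_i] := boolP (odd i).
    by rewrite /qscale IH ?mulr0 ?mul0r // ltnS leqW.
  rewrite [b (k - i)%N]IH ?mulr0 //; last by rewrite oddB // odd_k.
  by rewrite ltnS leqW // leq_subr.
split=> //; split=> [||n]; first by rewrite /sgn2 b0 mulr1.
  by rewrite /sgn2 b1 mulr0.
rewrite (@eq_conv _ (qscale q (sgn2 b)) (sgn2 (qscale q b)) (sgn2 b) (sgn2 b)) //; last first.
  by move=> i _; rewrite /sgn2 /qscale mulrCA.
rewrite conv_sgn2 => [|k odd_k]; last by rewrite /qscale b_odd ?mulr0.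
by rewrite {1}/sgn2 /= bE exprS; ring.
Qed.

End SignTwist.

(** * Sums over trees *)

Section TreeSums.
Variable R : comNzRingType.
Implicit Types (F G H : tree -> R) (q t c : R).

Definition tsum F (n : nat) : R := \sum_(s <- trees n) F s.

Lemma tsum0 F : tsum F 0 = F Leaf.
Proof. exact: big_trees0. Qed.

Lemma eq_tsum F G n : (forall s, nodes s = n -> F s = G s) -> tsum F n = tsum G n.
Proof.
move=> eq_FG; rewrite /tsum !big_seq; apply: eq_bigr => s.
by rewrite mem_trees => /eqP/eq_FG.
Qed.

Lemma tsumZ c F n : tsum (fun s => c * F s) n = c * tsum F n.
Proof. by rewrite /tsum big_distrr. Qed.

Lemma tsum_qscale q F n : tsum (fun s => q ^+ nodes s * F s) n = qscale q (tsum F) n.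
Proof. by rewrite /qscale -tsumZ; apply: eq_tsum => s ->. Qed.

(** A weight that factors over the two subtrees gives a product of series, the root accounting for
    one factor z. *)
Lemma tsum_node F G H n : (forall l r, F (Node l r) = G l * H r) ->
  tsum F n.+1 = conv (tsum G) (tsum H) n.
Proof.
move=> FE; rewrite /tsum big_treesS; apply: eq_bigr => k _.
rewrite big_distrl; apply: eq_bigr => l _ /=.
by rewrite big_distrr; apply: eq_bigr => r _.
Qed.

Lemma tsum_cond (P : pred tree) F n :
  \sum_(s <- trees n | P s) F s = tsum (fun s => (P s)%:R * F s) n.
Proof.
rewrite /tsum big_mkcond; apply: eq_bigr => s _.
by case: (P s); rewrite ?mul1r ?mul0r.
Qed.

Lemma tsum_nonleaf F n :
  tsum (fun s => (s != Leaf)%:R * F s) n = scons 0 (fun k => tsum F k.+1) n.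
Proof.
case: n => [|n]; first by rewrite tsum0 mul0r.
by apply: eq_tsum => -[//|l r] _; rewrite mul1r.
Qed.

(* [w31max] (resp. [w13max], [w13min]) is the weight of the word of [s] preceded
   by a letter larger (resp. larger, smaller) than all its letters. *)
Section Weights.
Variables (t q : R).

Definition w31 s := t ^+ desT s * q ^+ st31T s.
Definition w31max s := t ^+ ((s != Leaf) + desT s) * q ^+ (rnodes s + st31T s).
Definition w13 s := t ^+ desT s * q ^+ st13T s.
Definition w13max s := t ^+ ((s != Leaf) + desT s) * q ^+ st13T s.
Definition w13min s := t ^+ desT s * q ^+ (lnodes s + st13T s).

Lemma tsum_w31 n : tsum w31 n.+1 = conv (tsum w31max) (tsum w31) n.
Proof. by apply: tsum_node => l r; rewrite /w31 /w31max /= !exprD; ring. Qed.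

(** A larger letter in front creates a descent to the root, hence [t], enclosing the whole right
    subtree, hence the scaling by q. *)
Lemma tsum_w31max n :
  tsum w31max n.+1 = t * conv (tsum w31max) (qscale q (tsum w31)) n.
Proof.
rewrite -convZl.
rewrite (@tsum_node _ (fun s => t * w31max s) (fun s => q ^+ nodes s * w31 s)).
  by apply: eq_conv => i _; rewrite ?tsumZ ?tsum_qscale.
by move=> l r; rewrite /w31 /w31max /= !exprD; ring.
Qed.

(** Requiring a nonempty left subtree replaces E by E - 1. *)
Lemma tsum_coder_w31 n : tsum (fun s => (coderT s)%:R * w31 s) n.+1 =
  conv (scons 0 (fun k => tsum w31max k.+1)) (tsum (fun s => (coderT s)%:R * w31 s)) n.
Proof.
rewrite (@tsum_node _ (fun s => (s != Leaf)%:R * w31max s)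
                      (fun s => (coderT s)%:R * w31 s)).
  by apply: eq_conv => // i _; rewrite tsum_nonleaf.
by move=> l r; rewrite /w31 /w31max /= -mulnb natrM !exprD; ring.
Qed.

Lemma tsum_w13 n : tsum w13 n.+1 = conv (tsum w13max) (tsum w13min) n.
Proof. by apply: tsum_node => l r; rewrite /w13 /w13max /w13min /= !exprD; ring. Qed.

(** The ascent from a smaller first letter to the root encloses the whole left subtree. *)
Lemma tsum_w13min n :
  tsum w13min n.+1 = conv (qscale q (tsum w13max)) (tsum w13min) n.
Proof.
rewrite (@tsum_node _ (fun s => q ^+ nodes s * w13max s) w13min).
  by apply: eq_conv => // i _; rewrite tsum_qscale.
by move=> l r; rewrite /w13max /w13min /= !exprD; ring.
Qed.

(** A larger letter before a nonempty word adds one descent and no 13-2; this is P = 1 - t + tF. *)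
Lemma tsum_w13max n : tsum w13max n = scons 1 (fun k => t * tsum w13 k.+1) n.
Proof.
case: n => [|n]; first by rewrite tsum0 /w13max /= mulr1.
by rewrite /= -tsumZ; apply: eq_tsum => -[//|l r] _; rewrite /w13max exprS mulrA.
Qed.

Lemma tsum_coder_w13 n : tsum (fun s => (coderT s)%:R * w13 s) n.+1 =
  conv (scons 0 (fun k => tsum w13max k.+1)) (tsum (fun s => (coderT s)%:R * w13min s)) n.
Proof.
rewrite (@tsum_node _ (fun s => (s != Leaf)%:R * w13max s)
                      (fun s => (coderT s)%:R * w13min s)).
  by apply: eq_conv => // i _; rewrite tsum_nonleaf.
by move=> l r; rewrite /w13 /w13max /w13min /= -mulnb natrM !exprD; ring.
Qed.

Lemma tsum_coder_w13min n : tsum (fun s => (coderT s)%:R * w13min s) n.+1 =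
  conv (qscale q (scons 0 (fun k => tsum w13max k.+1)))
       (tsum (fun s => (coderT s)%:R * w13min s)) n.
Proof.
rewrite (@tsum_node _ (fun s => q ^+ nodes s * ((s != Leaf)%:R * w13max s))
                      (fun s => (coderT s)%:R * w13min s)).
  by apply: eq_conv => // i _; rewrite tsum_qscale /qscale tsum_nonleaf.
by move=> l r; rewrite /w13max /w13min /= -mulnb natrM !exprD; ring.
Qed.

End Weights.

(** * Down-up trees *)

Section DownUp.
Variable q : R.

Definition du13 s : R := (downup s)%:R * q ^+ st13T s.
Definition du13min s : R := (downup s)%:R * q ^+ (lnodes s + st13T s).
Definition ud13 s : R := (updown s)%:R * q ^+ st13T s.

(** An up-down tree has an empty left subtree: it is a least letter in front of a down-up word. *)
Lemma tsum_ud13 n : tsum ud13 n = scons 0 (tsum du13min) n.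
Proof.
case: n => [|n]; first by rewrite tsum0 /ud13 /= mul0r.
rewrite (@tsum_node _ (fun s => (s == Leaf)%:R) du13min); last first.
  move=> [|a b] r; rewrite /ud13 /du13min updown_node /= ?mul0r //.
  by rewrite mul1r add0n.
rewrite /conv big_ord_recl tsum0 eqxx mul1r subn0 big1 ?addr0 // => k _.
by rewrite /tsum big_seq big1 ?mul0r // => -[|a b]; rewrite mem_trees.
Qed.

Lemma du13_node n : tsum du13 n.+1 = conv (scons 0 (tsum du13min)) (tsum du13min) n.
Proof.
rewrite (@tsum_node _ ud13 du13min).
  by apply: eq_conv => // i _; rewrite tsum_ud13.
by move=> l r; rewrite /du13 /ud13 /du13min downup_node /= -mulnb natrM !exprD; ring.
Qed.

Lemma du13min_node n :
  tsum du13min n.+1 = conv (qscale q (scons 0 (tsum du13min))) (tsum du13min) n.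
Proof.
rewrite (@tsum_node _ (fun s => q ^+ nodes s * ud13 s) du13min).
  by apply: eq_conv => // i _; rewrite tsum_qscale /qscale tsum_ud13.
by move=> l r; rewrite /ud13 /du13min downup_node /= -mulnb natrM !exprD; ring.
Qed.

Lemma tsum_du13SS n : tsum du13 n.+2 = conv (tsum du13min) (tsum du13min) n.
Proof. by rewrite du13_node (@conv_shift _ _ _ (tsum du13min)). Qed.

Lemma du13min_spec : (forall k, odd k -> tsum du13min k = 0) /\
  qcat_spec q (sgn2 (tsum du13min)).
Proof.
apply: qcat_spec_sgn2 => [||n]; first by rewrite tsum0 /du13min /= mulr1.
  by rewrite du13min_node /conv big_ord_recl big_ord0 /qscale /= mulr0 mul0r addr0.
rewrite du13min_node (@conv_shift _ _ _ (fun k => q * qscale q (tsum du13min) k)).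
- exact: convZl.
- by rewrite /qscale /= mulr0.
- by move=> k; rewrite /qscale /= exprS mulrA.
Qed.

End DownUp.

(** * From permutations to trees *)

Lemma perm_rev_permutations n :
  perm_eq [seq rev w | w <- permutations (iota 0 n)] (permutations (iota 0 n)).
Proof.
apply: uniq_perm; rewrite ?permutations_uniq //.
  by rewrite map_inj_uniq ?permutations_uniq //; apply: can_inj revK.
move=> w; apply/mapP/idP => [[v + ->]|w_in].
  by rewrite !mem_permutations perm_rev.
by exists (rev w); rewrite ?revK // mem_permutations perm_rev -mem_permutations.
Qed.

Lemma sum_perm_trees n (A : pred 'S_n) (W : 'S_n -> R)
    (P : pred (seq nat)) (Fw : seq nat -> R) (Pt : pred tree) (Ft : tree -> R) :
  (forall p, A p = av231 (word p) && P (word p)) ->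
  (forall p, W p = Fw (word p)) ->
  (forall s, nodes s = n -> P (tword 0 s) = Pt s) ->
  (forall s, Fw (tword 0 s) = Ft s) ->
  \sum_(p : 'S_n | A p) W p = tsum (fun s => (Pt s)%:R * Ft s) n.
Proof.
move=> AE WE PE FE; rewrite (eq_bigl _ _ AE) (eq_bigr _ (fun p _ => WE p)).
rewrite (big_word n (fun w => av231 w && P w) Fw) (big_av231 n P Fw) tsum_cond.
by apply: eq_tsum => s sz; rewrite FE PE.
Qed.

(** Reindexing by reversal brings the sum to down-up 231-avoiding words weighted by 13-2. *)
Lemma Cstar_tsum q m : Cstar q m = tsum (du13 q) m.*2.
Proof.
rewrite /Cstar.
rewrite (eq_big (fun p : 'S_(m.*2) => av231 (rev (word p)) && altS true (rev (word p)))
                (fun p => q ^+ st_adj in13 (rev (word p)))); first last.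
- by move=> p _; rewrite st2_31E.
- by move=> p; rewrite alternatingE avoids132E andbC.
rewrite (big_word _ (fun w => av231 (rev w) && altS true (rev w))
                  (fun w => q ^+ st_adj in13 (rev w))).
rewrite -(perm_big _ (perm_rev_permutations _)) big_map /=.
under eq_bigl => w do rewrite revK.
under eq_bigr => w _ do rewrite revK.
rewrite (big_av231 _ (altS true) (fun w => q ^+ st_adj in13 w)) tsum_cond.
apply: eq_tsum => s sz; rewrite altS_tword st13_tword /du13 /downup sz odd_double.
by rewrite andbT.
Qed.

Lemma sum_av231_31 q t n :
  \sum_(p : 'S_n | avoids [:: 2; 3; 1] p) t ^+ des p * q ^+ st31_2 p = tsum (w31 t q) n.
Proof.
rewrite (@sum_perm_trees _ _ _ xpredT (fun w => t ^+ desS w * q ^+ st_adj in31 w)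
           xpredT (w31 t q)) => [|p|p|//|s].
- by apply: eq_tsum => s _; rewrite mul1r.
- by rewrite avoids231E andbT.
- by rewrite desE st31_2E.
- by rewrite desS_tword st31_tword.
Qed.

Lemma sum_av231_13 q t n :
  \sum_(p : 'S_n | avoids [:: 2; 3; 1] p) t ^+ des p * q ^+ st13_2 p = tsum (w13 t q) n.
Proof.
rewrite (@sum_perm_trees _ _ _ xpredT (fun w => t ^+ desS w * q ^+ st_adj in13 w)
           xpredT (w13 t q)) => [|p|p|//|s].
- by apply: eq_tsum => s _; rewrite mul1r.
- by rewrite avoids231E andbT.
- by rewrite desE st13_2E.
- by rewrite desS_tword st13_tword.
Qed.

Lemma sum_coder_31 q t n :
  \sum_(p : 'S_n | avoids [:: 2; 3; 1] p && coderangement p) t ^+ des p * q ^+ st31_2 p =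
  tsum (fun s => (coderT s)%:R * w31 t q s) n.
Proof.
apply: (@sum_perm_trees _ _ _ (coderS n 0) (fun w => t ^+ desS w * q ^+ st_adj in31 w)).
- by move=> p; rewrite avoids231E coderangementE.
- by move=> p; rewrite desE st31_2E.
- by move=> s sz; rewrite coderS_tword // add0n sz.
- by move=> s; rewrite desS_tword st31_tword.
Qed.

Lemma sum_coder_13 q t n :
  \sum_(p : 'S_n | avoids [:: 2; 3; 1] p && coderangement p) t ^+ des p * q ^+ st13_2 p =
  tsum (fun s => (coderT s)%:R * w13 t q s) n.
Proof.
apply: (@sum_perm_trees _ _ _ (coderS n 0) (fun w => t ^+ desS w * q ^+ st_adj in13 w)).
- by move=> p; rewrite avoids231E coderangementE.
- by move=> p; rewrite desE st13_2E.
- by move=> s sz; rewrite coderS_tword // add0n sz.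
- by move=> s; rewrite desS_tword st13_tword.
Qed.

(** * Evaluation of the tree sums *)

Lemma tsum_w31_qcat q n : tsum (w31 (-1) q) n = scons 1 (qcat_even q) n.
Proof.
apply: (des_st31_series (qcat_even_spec q) _ _ (tsum_w31 (-1) q) (tsum_w31max (-1) q));
  by rewrite tsum0 ?/w31 ?/w31max /= mulr1.
Qed.

Lemma tsum_w13_qcat q n : tsum (w13 (-1) q) n = scons 1 (qcat_even q) n.
Proof.
apply: (des_st13_series (qcat_even_spec q) _ _ _ (tsum_w13 (-1) q) (tsum_w13min (-1) q)).
- by rewrite tsum0 /w13 /= mulr1.
- by rewrite tsum0 /w13min /= mulr1.
- by move=> [|k]; rewrite tsum_w13max //= mulN1r.
Qed.

Lemma tsum_coder_w31_qcat q n :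
  tsum (fun s => (coderT s)%:R * w31 (- q) q s) n = qcat_even q n.
Proof.
apply: (coder_st31_series (qcat_even_spec q) _ _ _ (tsum_w31 (- q) q)
          (tsum_w31max (- q) q) (tsum_coder_w31 (- q) q)).
all: by rewrite tsum0 ?/w31 ?/w31max /= ?mulr1.
Qed.

Lemma tsum_coder_w13_qcat q n (d := tsum (fun s => (coderT s)%:R * w13 (-1) q s)) :
  d 1%N = 0 /\ d n.+2 = - conv (qcat_even q) (qcat_even q) n.
Proof.
(* At t = -1, P - 1 = 1 - F = - zA. *)
have w13maxE k : scons 0 (fun i => tsum (w13max (-1) q) i.+1) k =
    scons 0 (fun i => - qcat_even q i) k.
  by case: k => [//|k] /=; rewrite tsum_w13max /= tsum_w13_qcat mulN1r.
have [] := @coder_st13_series _ q _ (qcat_even_spec q)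
  (tsum (fun s => (coderT s)%:R * w13min (-1) q s)) d _ _ _ => //.
- by rewrite tsum0 /w13min /= !mulr1.
- by move=> k; rewrite /d tsum_coder_w13; apply: eq_conv.
- move=> k; rewrite tsum_coder_w13min; apply: eq_conv => // i _.
  by rewrite /qscale w13maxE.
Qed.

End TreeSums.

Unset Implicit Arguments.

Theorem theorem5p2 (R : comRingType) (q : R) (n : nat) (hn : (1 <= n)%N) :
  let S1 := \sum_(p : 'S_n | avoids [:: 2; 3; 1] p)
              (-1) ^+ des p * q ^+ st31_2 p in
  let S2 := \sum_(p : 'S_n | avoids [:: 2; 3; 1] p)
              (-1) ^+ des p * q ^+ st13_2 p in
  let D1 := \sum_(p : 'S_n | avoids [:: 2; 3; 1] p && coderangement p)
              (- q) ^+ des p * q ^+ st31_2 p in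
  let D2 := \sum_(p : 'S_n | avoids [:: 2; 3; 1] p && coderangement p)
              (-1) ^+ des p * q ^+ st13_2 p in
  [/\ S1 = S2,
      S1 = (if odd n then (- q) ^+ n./2 * Cq (q ^+ 2) n./2 else 0),
      D1 = (if odd n then 0 else (- q) ^+ n./2 * Cq (q ^+ 2) n./2)
    & D2 = (if odd n then 0 else (-1) ^+ n./2 * Cstar q n./2)].
Proof.
move=> S1 S2 D1 D2; rewrite /S1 /S2 /D1 /D2.
rewrite sum_av231_31 sum_av231_13 sum_coder_31 sum_coder_13.
rewrite tsum_w31_qcat tsum_w13_qcat tsum_coder_w31_qcat; split=> //.
  (* For n >= 1 the coefficient of z^n in 1 + zA is that of z^(n-1) in A, which exchanges the
     parities. *)
  case: n hn {S1 S2 D1 D2} => [//|n] _ /=; rewrite /qcat_even uphalf_half.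
  by case: (odd n).
case: n hn {S1 S2 D1 D2} => [//|[|n]] _; first by have [] := tsum_coder_w13_qcat q 0.
have [_ ->] := tsum_coder_w13_qcat q n.
have [du_odd du_spec] := du13min_spec q.
(* By uniqueness A is the sign twist of B, so - A^2 is B^2 with sign (-1)^(n/2 + 1) in degree [n],
   the exponent required for [n.+2]. *)
have qcatE := qcat_spec_unique (qcat_even_spec q) du_spec.
rewrite (@eq_conv _ _ (sgn2 (tsum (du13min q))) _ (sgn2 (tsum (du13min q)))) //.
rewrite conv_sgn2 // -tsum_du13SS /= negbK exprS mulN1r mulNr.
have [odd_n|even_n] := boolP (odd n).
  rewrite tsum_du13SS /conv big1 ?mulr0 ?oppr0 // => k _.
  have le_kn : (k <= n)%N by rewrite -ltnS.
  case odd_k: (odd k); first by rewrite du_odd // mul0r.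
  by rewrite [X in _ * X]du_odd ?mulr0 // oddB // odd_n odd_k.
have nE : (n./2.+1).*2 = n.+2.
  by rewrite doubleS -{2}(odd_double_half n) (negbTE even_n).
by rewrite Cstar_tsum nE.
Qed.
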